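(* Let $X,Y$ be complex Banach spaces, and let $A\in\mathcal{B}(X,Y)$ and $B,C\in\mathcal{B}(Y,X)$ satisfy $ABA=ACA$. Then for every $i\in\{1,2,\dots,19\}$, $$\sigma_{\mathbf{R}_i}(AC)\setminus\{0\}=\sigma_{\mathbf{R}_i}(BA)\setminus\{0\},$$ where $\sigma_{\mathbf{R}_i}(AC)$ is computed with respect to the class $\mathbf{R}_i\subseteq\mathcal{B}(Y)$ and $\sigma_{\mathbf{R}_i}(BA)$ with respect to the class $\mathbf{R}_i\subseteq\mathcal{B}(X)$.
   Context: $\mathcal{B}(X,Y)$ denotes the bounded linear operators from $X$ to $Y$, and $\mathcal{B}(X)=\mathcal{B}(X,X)$. $\mathbb{N}=\{0,1,2,\dots\}$. For $T\in\mathcal{B}(Z)$ ($Z$ a Banach space), $\mathcal{N}(T)$ is the kernel and $\mathcal{R}(T)$ the range; $T^0=I$. Dimensions take values in $\{0,1,2,\dots,\infty\}$ and are algebraic dimensions of (quotient) vector spaces. For $n\in\mathbb{N}$: $c_n(T)=\dim \mathcal{R}(T^n)/\mathcal{R}(T^{n+1})$; $c_n'(T)=\dim \mathcal{N}(T^{n+1})/\mathcal{N}(T^n)$; $k_n(T)$ is the dimension of the null space of the linear map $\mathcal{R}(T^n)/\mathcal{R}(T^{n+1})\to\mathcal{R}(T^{n+1})/\mathcal{R}(T^{n+2})$ induced by $T$; equivalently $k_n(T)=\dim(\mathcal{N}(T)\cap\mathcal{R}(T^n))/(\mathcal{N}(T)\cap\mathcal{R}(T^{n+1}))$. Set $c(T)=\sum_{n\ge0}c_n(T)$,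 $c'(T)=\sum_{n\ge0}c_n'(T)$, $k(T)=\sum_{n\ge0}k_n(T)$. For a Banach space $Z$, the classes $\mathbf{R}_i\subseteq\mathcal{B}(Z)$ consist of those $T\in\mathcal{B}(Z)$ satisfying: $\mathbf{R}_1$: $c(T)=0$. $\mathbf{R}_2$: $c(T)<\infty$. $\mathbf{R}_3$: there exists $d\in\mathbb{N}$ such that $c_d(T)=0$ and $\mathcal{R}(T^{d+1})$ is closed. $\mathbf{R}_4$: $c_n(T)<\infty$ for every $n\in\mathbb{N}$. $\mathbf{R}_5$: there exists $d\in\mathbb{N}$ such that $c_d(T)<\infty$ and $\mathcal{R}(T^{d+1})$ is closed. $\mathbf{R}_6$: $c'(T)=0$ and $\mathcal{R}(T)$ is closed. $\mathbf{R}_7$: $c'(T)<\infty$ and $\mathcal{R}(T)$ is closed. $\mathbf{R}_8$: there exists $d\in\mathbb{N}$ such that $c_d'(T)=0$ and $\mathcal{R}(T^{d+1})$ is closed. $\mathbf{R}_9$: $c_n'(T)<\infty$ for every $n\in\mathbb{N}$ and $\mathcal{R}(T)$ is closed. $\mathbf{R}_{10}$: there exists $d\in\mathbb{N}$ such that $c_d'(T)<\infty$ and $\mathcal{R}(T^{d+1})$ is closed. $\mathbf{R}_{11}$: $k(T)=0$ and $\mathcal{R}(T)$ is closed. $\mathbf{R}_{12}$: $k(T)<\infty$ and $\mathcal{R}(T)$ is closed. $\mathbf{R}_{13}$: there exists $d\in\mathbb{N}$ such that $k_n(T)=0$ for every $n\ge d$ and $\mathcal{R}(T^{d+1})$ is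 closed. $\mathbf{R}_{14}$: $k_n(T)<\infty$ for every $n\in\mathbb{N}$ and $\mathcal{R}(T)$ is closed. $\mathbf{R}_{15}$: there exists $d\in\mathbb{N}$ such that $k_n(T)<\infty$ for every $n\ge d$ and $\mathcal{R}(T^{d+1})$ is closed. $\mathbf{R}_{16}$: there exists $d\in\mathbb{N}$ such that $c_d(T)=0$ and $\mathcal{R}(T)+\mathcal{N}(T^d)$ is closed. $\mathbf{R}_{17}$: there exists $d\in\mathbb{N}$ such that $c_d(T)<\infty$ and $\mathcal{R}(T)+\mathcal{N}(T^d)$ is closed. $\mathbf{R}_{18}$: there exists $d\in\mathbb{N}$ such that $k_n(T)=0$ for every $n\ge d$ and $\mathcal{R}(T)+\mathcal{N}(T^d)$ is closed. $\mathbf{R}_{19}$: there exists $d\in\mathbb{N}$ such that $k_n(T)<\infty$ for every $n\ge d$ and $\mathcal{R}(T)+\mathcal{N}(T^d)$ is closed. For $T\in\mathcal{B}(Z)$, $\sigma_{\mathbf{R}_i}(T)=\{\lambda\in\mathbb{C}:\lambda I-T\notin\mathbf{R}_i\}$. *)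

(* Defs.v *)
From HB Require Import structures.
From mathcomp Require Import all_boot all_order all_algebra.
From mathcomp Require Import complex.
From mathcomp Require Import all_classical all_reals all_analysis.

Set Implicit Arguments.
Unset Strict Implicit.
Unset Printing Implicit Defensive.

Import Order.TTheory GRing.Theory Num.Theory.
Import numFieldNormedType.Exports.

Local Open Scope classical_set_scope.
Local Open Scope complex_scope.
Local Open Scope ring_scope.

Definition bounded_operator (R : realType) (X Y : normedModType R[i])
    (f : X -> Y) : Prop :=
  exists M : R, forall x : X, `|f x| <= M%:C * `|x|.

Section QuotientDimension.
Variables (R : realType) (Z : lmodType R[i]).

(* The classes of e 0, ..., e (n - 1) form a basis of U / V; U and V are meant
   to be linear subspaces of Z with V contained in U. *)
Definition quotient_basis (U V : set Z) (n : nat) (e : 'I_n -> Z) : Prop :=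
  [/\ forall j, U (e j),
      forall a : 'I_n -> R[i], V (\sum_j a j *: e j) -> forall j, a j = 0 &
      forall u, U u -> exists a : 'I_n -> R[i], V (u - \sum_j a j *: e j)].

(* All finite bases of U / V have the same size, so the infimum is over a set
   with at most one element; it is +oo when U / V has no finite basis. *)
Definition quotient_dim (U V : set Z) : \bar R :=
  ereal_inf [set n%:R%:E | n in
    [set n : nat | exists e : 'I_n -> Z, quotient_basis U V e]].

End QuotientDimension.

Section Classes.
Variables (R : realType) (Z : completeNormedModType R[i]).
Implicit Types (T : {linear Z -> Z}) (n : nat).

Definition range_pow T n : set Z := range (iter n T).

Definition ker_pow T n : set Z := [set x | iter n T x = 0].

Definition c_ T n : \bar R := quotient_dim (range_pow T n) (range_pow T n.+1).

Definition c'_ T n : \bar R := quotient_dim (ker_pow T n.+1) (ker_pow T n).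

(* The map x + R(T^n.+1) |-> T x + R(T^n.+2) on R(T^n) / R(T^n.+1) kills the
   class of x exactly when T x belongs to R(T^n.+2). *)
Definition k_ T n : \bar R :=
  quotient_dim (range_pow T n `&` T @^-1` range_pow T n.+2)
               (range_pow T n.+1).

Definition c_sum T : \bar R := (\sum_(0 <= n <oo) c_ T n)%E.

Definition c'_sum T : \bar R := (\sum_(0 <= n <oo) c'_ T n)%E.

Definition k_sum T : \bar R := (\sum_(0 <= n <oo) k_ T n)%E.

Definition range_plus_ker T n : set Z :=
  [set x + y | x in range T & y in ker_pow T n].

Definition class_cond (i : nat) T : Prop :=
  match i with
  | 1 => c_sum T = 0%E
  | 2 => (c_sum T < +oo)%E
  | 3 => exists d, c_ T d = 0%E /\ closed (range_pow T d.+1)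
  | 4 => forall n, (c_ T n < +oo)%E
  | 5 => exists d, (c_ T d < +oo)%E /\ closed (range_pow T d.+1)
  | 6 => c'_sum T = 0%E /\ closed (range T)
  | 7 => (c'_sum T < +oo)%E /\ closed (range T)
  | 8 => exists d, c'_ T d = 0%E /\ closed (range_pow T d.+1)
  | 9 => (forall n, (c'_ T n < +oo)%E) /\ closed (range T)
  | 10 => exists d, (c'_ T d < +oo)%E /\ closed (range_pow T d.+1)
  | 11 => k_sum T = 0%E /\ closed (range T)
  | 12 => (k_sum T < +oo)%E /\ closed (range T)
  | 13 => exists d, (forall n, (d <= n)%N -> k_ T n = 0%E) /\
                    closed (range_pow T d.+1)
  | 14 => (forall n, (k_ T n < +oo)%E) /\ closed (range T)
  | 15 => exists d, (forall n, (d <= n)%N -> (k_ T n < +oo)%E) /\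
                    closed (range_pow T d.+1)
  | 16 => exists d, c_ T d = 0%E /\ closed (range_plus_ker T d)
  | 17 => exists d, (c_ T d < +oo)%E /\ closed (range_plus_ker T d)
  | 18 => exists d, (forall n, (d <= n)%N -> k_ T n = 0%E) /\
                    closed (range_plus_ker T d)
  | 19 => exists d, (forall n, (d <= n)%N -> (k_ T n < +oo)%E) /\
                    closed (range_plus_ker T d)
  | _ => False
  end.

Definition class_R (i : nat) : set {linear Z -> Z} :=
  [set T : {linear Z -> Z} | bounded_operator T /\ class_cond i T].

Definition sigma_R (i : nat) (T : {linear Z -> Z}) : set R[i] :=
  [set lambda | ~ class_R i (lambda \*: idfun \- T : {linear Z -> Z})].

End Classes.

(* Main.v *)
(** For [lambda != 0] put [S = lambda - AC], [T = lambda - BA] and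
    [D = lambda^-2 BAC].  The hypothesis [ABA = ACA] gives [AT = SA], [DS = TD],
    and [AD = lambda^-2 (AC)^2], [DA = lambda^-2 (BA)^2] differ from the
    identity by [SQ] and [TP], with [Q], [P] the same polynomial in [S], [T].
    Hence [A] and [D] induce mutually inverse maps between the quotients that
    define [c_n], [c'_n], [k_n] for [T] and [S]; and the ranges (and
    range-plus-kernel sums) of [S] are the preimages under the continuous map
    [D] of those of [T], so they are closed together. *)

Require Import Defs.
From HB Require Import structures.
From mathcomp Require Import all_boot all_order all_algebra.
From mathcomp Require Import complex.
From mathcomp Require Import all_classical all_reals all_analysis.
Import Order.TTheory GRing.Theory Num.Theory.
Import numFieldNormedType.Exports.
Local Open Scope classical_set_scope.
Local Open Scope complex_scope.
Local Open Scope ring_scope.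

(** * Linear subspaces, and ranges and kernels of iterates *)

Definition linear_subspace {K : pzRingType} {Z : lmodType K} (U : set Z) : Prop :=
  U 0 /\ forall a u v, U u -> U v -> U (a *: u + v).

Section LinearSubspace.
Context {K : pzRingType} {Z W : lmodType K}.
Implicit Types U V : set Z.

Lemma linear_subspaceD U u v : linear_subspace U -> U u -> U v -> U (u + v).
Proof. by move=> [_ hU] uU vU; rewrite -[u]scale1r; exact: hU. Qed.

Lemma linear_subspace_sum U n (a : 'I_n -> K) (e : 'I_n -> Z) :
  linear_subspace U -> (forall j, U (e j)) -> U (\sum_j a j *: e j).
Proof.
move=> [U0 hU] eU; elim/big_rec: _ => [//|j x _ xU].
exact: hU.
Qed.

Lemma linear_subspaceI U V :
  linear_subspace U -> linear_subspace V -> linear_subspace (U `&` V).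
Proof.
move=> [U0 hU] [V0 hV]; split=> [//|a u v [uU uV] [vU vV]].
by split; [exact: hU|exact: hV].
Qed.

Lemma linear_subspace_preimage (f : {linear Z -> W}) (U : set W) :
  linear_subspace U -> linear_subspace (f @^-1` U).
Proof.
move=> [U0 hU]; split=> [|a u v uU vU]; rewrite /preimage /= ?linear0//.
by rewrite linearP; exact: hU.
Qed.

End LinearSubspace.

Lemma iter_linear {K : pzRingType} {Z : lmodType K} (T : {linear Z -> Z}) n :
  linear (iter n T).
Proof. by elim: n => [//|n IH] a u v /=; rewrite IH linearP. Qed.

Lemma iter_linear0 {K : pzRingType} {Z : lmodType K} (T : {linear Z -> Z}) n :
  iter n T 0 = 0.
Proof. by elim: n => [//|n /= ->]; rewrite linear0. Qed.

Lemma iter_intertwine {Z W : Type} {f : Z -> W} {t : Z -> Z} {s : W -> W} :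
  (forall x, f (t x) = s (f x)) ->
  forall n x, f (iter n t x) = iter n s (f x).
Proof. by move=> h; elim=> [//|n IH] x /=; rewrite h IH. Qed.

Section Subspaces.
Context {R : realType} {Z : completeNormedModType R[i]}.
Implicit Type T : {linear Z -> Z}.

Lemma linear_subspace_range_pow T n : linear_subspace (range_pow T n).
Proof.
split=> [|a _ _ [u _ <-] [v _ <-]]; first by exists 0; rewrite ?iter_linear0.
by exists (a *: u + v); rewrite ?iter_linear.
Qed.

Lemma linear_subspace_ker_pow T n : linear_subspace (ker_pow T n).
Proof.
rewrite /ker_pow; split=> [|a u v /= hu hv]; first exact: iter_linear0.
by rewrite iter_linear hu hv scaler0 addr0.
Qed.

End Subspaces.

(** * Comparison of quotient dimensions *)

Section QuotientDim.
Context {R : realType} {Z W : lmodType R[i]}.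
Variables (f : {linear Z -> W}) (g : {linear W -> Z}).
Variables (U V : set Z) (U' V' : set W).

(** The map [f] sends a basis of [U / V] to a basis of [U' / V'], so every size in the first infimum
    also occurs in the second. Exchanging [f] and [g] gives the reverse inequality. *)
Lemma quotient_dim_le :
  linear_subspace U -> linear_subspace V -> linear_subspace V' ->
  (forall u, U u -> U' (f u)) -> (forall u, V u -> V' (f u)) ->
  (forall u, U' u -> U (g u)) -> (forall u, V' u -> V (g u)) ->
  (forall u, U u -> V (u - g (f u))) -> (forall u, U' u -> V' (u - f (g u))) ->
  (quotient_dim U' V' <= quotient_dim U V)%E.
Proof.
move=> sU sV sV' fU fV gU gV gf fg; apply: ereal_inf_le_tmp => _ [n [e [eU ei eg]] <-].
have fsum (a : 'I_n -> R[i]) :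
    \sum_j a j *: f (e j) = f (\sum_j a j *: e j).
  by rewrite linear_sum; apply: eq_bigr => j _; rewrite linearZ.
exists n => //; exists (f \o e); split=> [j|a|u uU'] /=.
- exact: fU.
(* Independence: a combination [s] with [f s] in [V'] has both [g (f s)] and [s - g (f s)] in
   [V]. *)
- rewrite fsum => /gV h; apply: ei.
  rewrite -[X in V X](subrK (g (f (\sum_j a j *: e j)))).
  by apply: linear_subspaceD => //; apply: gf; exact: linear_subspace_sum.
(* Spanning: expand [g u] as [s] modulo [V]; then [u - f s] is the sum of [u - f (g u)] and
   [f (g u - s)]. *)
- have [a ha] := eg _ (gU _ uU'); exists a.
  rewrite fsum -(subrK (f (g u)) u) -addrA -linearB.
  by apply: linear_subspaceD => //; [exact: fg|exact: fV].
Qed.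

End QuotientDim.

(** * Bounded operators over the ordered field [R[i]] *)

Lemma bounded_operatorP {R : realType} {X Y : normedModType R[i]} (f : X -> Y) :
  bounded_operator f <->
  exists2 M : R[i], 0 <= M & forall x, `|f x| <= M * `|x|.
Proof.
split=> [[M hM]|[M M0 hM]].
  exists `|M%:C|; first exact: normr_ge0.
  move=> x; apply: le_trans (hM x) _; apply: ler_wpM2r => //.
  by apply: real_ler_norm; rewrite complex_real.
(* A nonnegative element of [R[i]] is real, hence equal to its real part. *)
by exists (complex.Re M) => x; rewrite RRe_real// ger0_real.
Qed.

Section BoundedOperator.
Context {R : realType} {X Y Z : normedModType R[i]}.

Lemma bounded_operator_comp (f : Y -> Z) (g : X -> Y) :
  bounded_operator f -> bounded_operator g -> bounded_operator (f \o g).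
Proof.
move=> /bounded_operatorP[M M0 hM] /bounded_operatorP[N N0 hN].
apply/bounded_operatorP; exists (M * N) => [|x]; first exact: mulr_ge0.
by apply: le_trans (hM _) _; rewrite -mulrA ler_wpM2l.
Qed.

Lemma bounded_operatorZ (a : R[i]) (f : X -> Y) :
  bounded_operator f -> bounded_operator (a \*: f).
Proof.
move=> /bounded_operatorP[M M0 hM]; apply/bounded_operatorP.
exists (`|a| * M) => [|x]; first exact: mulr_ge0.
by rewrite normrZ -mulrA ler_wpM2l.
Qed.

Lemma bounded_operatorB (f g : X -> Y) :
  bounded_operator f -> bounded_operator g -> bounded_operator (f \- g).
Proof.
move=> /bounded_operatorP[M M0 hM] /bounded_operatorP[N N0 hN].
apply/bounded_operatorP; exists (M + N) => [|x]; first exact: addr_ge0.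
by apply: le_trans (ler_normB _ _) _; rewrite mulrDl lerD.
Qed.

Lemma bounded_operator_continuous (f : {linear X -> Y}) :
  bounded_operator f -> continuous f.
Proof.
move=> /bounded_operatorP[M M0 hM]; apply: bounded_linear_continuous.
apply/linear_boundedP; near=> r => x.
apply: le_trans (hM x) _; apply: ler_wpM2r => //.
near: r; apply: nbhs_pinfty_ge; exact: ger0_real.
Unshelve. all: by end_near. Qed.

End BoundedOperator.

Lemma bounded_operator_idfun {R : realType} {X : normedModType R[i]} :
  bounded_operator (idfun : X -> X).
Proof. by apply/bounded_operatorP; exists 1 => // x; rewrite mul1r. Qed.

(** [A] and [D] are mutually inverse up to errors [T P] and [S Q]. Of the polynomials [P] and [Q]
    only their commutation with [T] and [S] is retained; it makes the errors gain one power of the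
    operator. The conditions are symmetric, so each one-sided result below also yields its
    converse. *)
Definition inverse_modulo {R : realType} {X Y : completeNormedModType R[i]}
    (T : {linear X -> X}) (S : {linear Y -> Y})
    (A : {linear X -> Y}) (D : {linear Y -> X})
    (P : {linear X -> X}) (Q : {linear Y -> Y}) : Prop :=
  [/\ (forall x, A (T x) = S (A x)) /\ (forall y, D (S y) = T (D y)),
      forall x, x - D (A x) = T (P x),
      forall y, y - A (D y) = S (Q y),
      forall x, P (T x) = T (P x) &
      forall y, Q (S y) = S (Q y)].

(** * Action of [A] and of the error [x - D (A x)] on ranges and kernels *)

Section InverseModulo.
Context {R : realType} {X Y : completeNormedModType R[i]}.
Context {T : {linear X -> X}} {S : {linear Y -> Y}}.
Context {A : {linear X -> Y}} {D : {linear Y -> X}}.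
Context {P : {linear X -> X}} {Q : {linear Y -> Y}}.
Hypothesis h : inverse_modulo T S A D P Q.

Lemma inverse_modulo_sym : inverse_modulo S T D A Q P.
Proof. by case: h => -[AT DS] hX hY PT QS. Qed.

Lemma inverse_modulo_range_pow n x : range_pow T n x -> range_pow S n (A x).
Proof.
by case: h => -[AT _] _ _ _ _ [z _ <-]; exists (A z); rewrite ?(iter_intertwine AT).
Qed.

Lemma inverse_modulo_ker_pow n x : ker_pow T n x -> ker_pow S n (A x).
Proof.
by case: h => -[AT _] _ _ _ _; rewrite /ker_pow /= -(iter_intertwine AT) => ->;
  rewrite linear0.
Qed.

(** For x = T^n z the error is T P T^n z = T^(n+1) P z. *)
Lemma inverse_modulo_sub_range_pow n x :
  range_pow T n x -> range_pow T n.+1 (x - D (A x)).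
Proof.
case: h => _ -> _ PT _ [z _ <-]; exists (P z) => //=.
by rewrite (iter_intertwine PT).
Qed.

(** Here T^n applied to the error is T^(n+1) P x = P T^(n+1) x = 0. *)
Lemma inverse_modulo_sub_ker_pow n x :
  ker_pow T n.+1 x -> ker_pow T n (x - D (A x)).
Proof.
case: h => _ -> _ PT _; rewrite /ker_pow /= => hx.
by rewrite -iterSr -(iter_intertwine PT) /= hx linear0.
Qed.

End InverseModulo.

(** * Transfer of dimensions, ranges and closedness from [T] to [S] *)

Section Transfer.
Context {R : realType} {X Y : completeNormedModType R[i]}.
Context {T : {linear X -> X}} {S : {linear Y -> Y}}.
Context {A : {linear X -> Y}} {D : {linear Y -> X}}.
Context {P : {linear X -> X}} {Q : {linear Y -> Y}}.
Hypothesis h : inverse_modulo T S A D P Q.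
Let h' := inverse_modulo_sym h.

Lemma c_le n : (c_ S n <= c_ T n)%E.
Proof.
apply: (quotient_dim_le A D); try exact: linear_subspace_range_pow.
- exact: inverse_modulo_range_pow h n.
- exact: inverse_modulo_range_pow h n.+1.
- exact: inverse_modulo_range_pow h' n.
- exact: inverse_modulo_range_pow h' n.+1.
- exact: inverse_modulo_sub_range_pow h n.
- exact: inverse_modulo_sub_range_pow h' n.
Qed.

Lemma c'_le n : (c'_ S n <= c'_ T n)%E.
Proof.
apply: (quotient_dim_le A D); try exact: linear_subspace_ker_pow.
- exact: inverse_modulo_ker_pow h n.+1.
- exact: inverse_modulo_ker_pow h n.
- exact: inverse_modulo_ker_pow h' n.+1.
- exact: inverse_modulo_ker_pow h' n.
- exact: inverse_modulo_sub_ker_pow h n.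
- exact: inverse_modulo_sub_ker_pow h' n.
Qed.

(** As for [c_le], except that the numerator also constrains [T x]; [A] respects this constraint
    because S A x = A T x, and [D] likewise. *)
Lemma k_le n : (k_ S n <= k_ T n)%E.
Proof.
have [[AT DS] _ _ _ _] := h.
apply: (quotient_dim_le A D); try exact: linear_subspace_range_pow.
- apply: linear_subspaceI; first exact: linear_subspace_range_pow.
  exact: linear_subspace_preimage (linear_subspace_range_pow _ _).
- move=> u [uT Tu]; split; first exact: inverse_modulo_range_pow h _ _ uT.
  by rewrite /preimage /= -AT; exact: (inverse_modulo_range_pow h n.+2).
- exact: inverse_modulo_range_pow h n.+1.
- move=> u [uS Su]; split; first exact: inverse_modulo_range_pow h' _ _ uS.
  by rewrite /preimage /= -DS; exact: (inverse_modulo_range_pow h' n.+2).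
- exact: inverse_modulo_range_pow h' n.+1.
- by move=> u [+ _]; exact: inverse_modulo_sub_range_pow h n u.
- by move=> u [+ _]; exact: inverse_modulo_sub_range_pow h' n u.
Qed.

(** The preimage form lets closedness be pulled back along a continuous [D]. *)
Lemma range_pow_preimage n : range_pow S n = D @^-1` range_pow T n.
Proof.
apply/seteqP; split=> y; first exact: (inverse_modulo_range_pow h').
move=> /(inverse_modulo_range_pow h) ADy.
have range_decr m k : range_pow S (m + k) `<=` range_pow S m.
  by move=> _ [z _ <-]; exists (iter k S z); rewrite ?iterD.
(* Bootstrap on [m]: if y is in R(S^m), then y - A D y is in R(S^(m+1)), while A D y is in R(S^n),
   which lies in R(S^(m+1)) as long as m < n. *)
have: forall m, (m <= n)%N -> range_pow S m y; last exact.
elim=> [_|m IH mn]; first by exists y.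
rewrite -(subrK (A (D y)) y).
apply: linear_subspaceD; first exact: linear_subspace_range_pow.
  exact: inverse_modulo_sub_range_pow h' _ _ (IH (ltnW mn)).
by apply: (range_decr _ (n - m.+1)%N); rewrite subnKC.
Qed.

Lemma inverse_modulo_range_plus_ker d x :
  range_plus_ker T d x -> range_plus_ker S d (A x).
Proof.
case: (h) => -[AT _] _ _ _ _ [_ [z _ <-] [w wd <-]].
exists (S (A z)); first by exists (A z).
exists (A w); first exact: inverse_modulo_ker_pow h _ _ wd.
by rewrite linearD AT.
Qed.

End Transfer.

Section TransferClasses.
Context {R : realType} {X Y : completeNormedModType R[i]}.
Context {T : {linear X -> X}} {S : {linear Y -> Y}}.
Context {A : {linear X -> Y}} {D : {linear Y -> X}}.
Context {P : {linear X -> X}} {Q : {linear Y -> Y}}.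
Hypothesis h : inverse_modulo T S A D P Q.
Let h' := inverse_modulo_sym h.

Lemma range_plus_ker_preimage d :
  range_plus_ker S d = D @^-1` range_plus_ker T d.
Proof.
apply/seteqP; split=> y; first exact: (inverse_modulo_range_plus_ker h').
move=> /(inverse_modulo_range_plus_ker h) [_ [z _ <-] [w wd ADy]].
have [_ _ hY _ _] := h.
exists (S (Q y + z)); first by exists (Q y + z).
by exists w => //; rewrite linearD -hY -addrA ADy subrK.
Qed.

Hypothesis D_bounded : bounded_operator D.

Lemma closed_preimage (V : set X) : closed V -> closed (D @^-1` V).
Proof.
by apply: closed_comp => y _; exact: bounded_operator_continuous.
Qed.

Lemma class_cond_transfer i : class_cond i T -> class_cond i S.
Proof.
have cE : c_ S = c_ T.
  by apply/funext => n; apply/eqP; rewrite eq_le (c_le h) (c_le h').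
have c'E : c'_ S = c'_ T.
  by apply/funext => n; apply/eqP; rewrite eq_le (c'_le h) (c'_le h').
have kE : k_ S = k_ T.
  by apply/funext => n; apply/eqP; rewrite eq_le (k_le h) (k_le h').
have cl n : closed (range_pow T n) -> closed (range_pow S n).
  by rewrite (range_pow_preimage h); exact: closed_preimage.
have cl1 : closed (range T) -> closed (range S) := cl 1%N.
have clk d : closed (range_plus_ker T d) -> closed (range_plus_ker S d).
  by rewrite range_plus_ker_preimage; exact: closed_preimage.
(* The 20 cases are index 0, whose condition is [False], and the classes 1 to 19; larger indices
   again give [False]. *)
do 20 (case: i => [|i] /=; first by
  rewrite /c_sum /c'_sum /k_sum ?cE ?c'E ?kE //;
  first [ by move=> [? ?]; split; [|exact: cl1]
        | by move=> [d [? ?]]; exists d; split; [|first [exact: cl|exact: clk]]]).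
by [].
Qed.

End TransferClasses.

(** * Factorization of a^2 - M^2 *)

Section DifferenceOfSquares.
Context {K : fieldType} {Z : lmodType K} (M : {linear Z -> Z}) (a : K).

(** This is a^2 - M^2 = (a - M)(a + M) divided by a^2. The second factor, scaled by a^-2, supplies
    [P] for M = BA and [Q] for M = AC. *)
Lemma linear_sub_sqr x : a != 0 ->
  x - a ^- 2 *: M (M x) =
  (a \*: idfun \- M) ((a ^- 2 \*: (a \*: idfun \+ M)) x).
Proof.
move=> a0; rewrite /= [M (a ^- 2 *: _)]linearZ [M (a *: _ + _)]linearD.
rewrite /= [M (a *: x)]linearZ /=.
rewrite scalerA [a * _]mulrC -scalerA -scalerBr [a *: (_ + _)]scalerDr.
rewrite opprD addrA addrK scalerBr !scalerA -mulrA -expr2 mulVf ?scale1r//.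
by rewrite expf_neq0.
Qed.

Lemma linear_sub_sqr_comm x :
  (a ^- 2 \*: (a \*: idfun \+ M)) ((a \*: idfun \- M) x) =
  (a \*: idfun \- M) ((a ^- 2 \*: (a \*: idfun \+ M)) x).
Proof.
rewrite /= [M (a ^- 2 *: _)]linearZ /= scalerA [a * _]mulrC -scalerA -scalerBr.
congr (_ *: _).
rewrite [M (_ - _)]linearB [M (_ + _)]linearD /= [M (a *: x)]linearZ /=.
by rewrite scalerBr scalerDr opprD !addrA subrK addrK.
Qed.

End DifferenceOfSquares.

(** * Application to lambda - AC and lambda - BA *)

Theorem theorem2p8 (R : realType) (X Y : completeNormedModType R[i])
    (A : {linear X -> Y}) (B C : {linear Y -> X})
    (hA : bounded_operator A) (hB : bounded_operator B)
    (hC : bounded_operator C)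
    (hABA : A \o B \o A = A \o C \o A :> (X -> Y))
    (i : nat) (hi : (1 <= i <= 19)%N) :
  sigma_R i (A \o C : {linear Y -> Y}) `\ 0 =
  sigma_R i (B \o A : {linear X -> X}) `\ 0.
Proof.
have ABA x : A (B (A x)) = A (C (A x)) by have := congr1 (@^~ x) hABA.
suff classE (lambda : R[i]) : lambda != 0 ->
    class_R i (lambda \*: idfun \- (A \o C) : {linear Y -> Y}) <->
    class_R i (lambda \*: idfun \- (B \o A) : {linear X -> X}).
  apply/seteqP; split=> l [hl /= /eqP l0]; split; try exact/eqP.
    by move=> /(classE _ l0).
  by move=> /(classE _ l0).
move=> l0.
set S := (_ \- (A \o C) : {linear Y -> Y}).
set T := (_ \- (B \o A) : {linear X -> X}).
pose D := (lambda ^- 2 \*: (B \o A \o C) : {linear Y -> X}).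
pose P := (lambda ^- 2 \*: (lambda \*: idfun \+ (B \o A)) : {linear X -> X}).
pose Q := (lambda ^- 2 \*: (lambda \*: idfun \+ (A \o C)) : {linear Y -> Y}).
have hD : bounded_operator D.
  apply/bounded_operatorZ/bounded_operator_comp => //.
  exact: bounded_operator_comp.
have hS : bounded_operator S.
  apply: bounded_operatorB; last exact: bounded_operator_comp.
  by apply: bounded_operatorZ; exact: bounded_operator_idfun.
have hT : bounded_operator T.
  apply: bounded_operatorB; last exact: bounded_operator_comp.
  by apply: bounded_operatorZ; exact: bounded_operator_idfun.
have h : inverse_modulo T S A D P Q.
  split; [split| | |exact: linear_sub_sqr_comm|exact: linear_sub_sqr_comm].
  - by move=> x; rewrite /= linearB linearZ /= ABA.
  (* D S = T D reduces to BAC AC = B(ACA)C = B(ABA)C = BA BAC. *)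
  - move=> y; rewrite /= [C (_ - _)]linearB [A (_ - _)]linearB.
    rewrite [B (_ - _)]linearB /= [C (_ *: _)]linearZ [A (_ *: _)]linearZ.
    rewrite [B (_ *: _)]linearZ /= [A (lambda ^- 2 *: _)]linearZ.
    by rewrite [B (lambda ^- 2 *: _)]linearZ ABA scalerBr !scalerA mulrC.
  (* The hypothesis gives BAC A = B(ABA) = (BA)^2, and below A BAC = (ACA)C = (AC)^2. *)
  - move=> x; apply: etrans (linear_sub_sqr (B \o A) lambda x l0).
    by rewrite /= ABA.
  - move=> y; apply: etrans (linear_sub_sqr (A \o C) lambda y l0).
    by rewrite /= [A (_ *: _)]linearZ /= ABA.
(* From [S] to [T] closed sets are pulled back along [A], and from [T] to [S] along [D]; hence the
   two boundedness facts. *)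
split=> -[_ hi']; split=> //.
  exact: (class_cond_transfer (inverse_modulo_sym h) hA).
exact: (class_cond_transfer h hD).
Qed.
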